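(* For every integer $n\ge 1$ the following identities hold: (i) $\tau(n) = \frac{5\cdot 691}{9504}\sigma(n) - \frac{(6n-5)\cdot 691}{864} \sigma_9(n) + \frac{2275}{1584}\sigma_{11}(n) - \frac{5\cdot 691}{36} \sum^{n-1}_{m=1}\sigma(m)\sigma_9(n-m)$; (ii) $\tau(n) = \frac{15}{32}n\sigma(n)-\frac{33}{32}n\sigma_9(n)+\frac{50}{32}n^2\sigma_7(n) +225 \sum^{n-1}_{m=1}m\sigma(m)\sigma_7(n-m)$; (iii) $\tau(n) = \frac{6}{7}n^2\sigma(n) -\frac{9}{7}n^3\sigma_5(n) +\frac{10}{7}n^2\sigma_7(n) -24\cdot 18 \sum^{n-1}_{m=1}m^2\sigma(m)\sigma_5(n-m)$; (iv) $\tau(n) = \frac{14}{5}n^3\sigma(n)+\frac{12}{5}n^4\sigma_3(n)-\frac{21}{5}n^3\sigma_5(n) + 24\cdot 28 \sum^{n-1}_{m=1}m^3\sigma(m)\sigma_3(n-m)$; (v) $\tau(n) = \frac{5}{12}n\sigma(n)+\frac{25}{24}n\sigma_7(n)-\frac{11}{24}n\sigma_9(n) +25\sum^{n-1}_{m=1}(9m-n)\sigma(m)\sigma_7(n-m)$; (vi) $\tau(n) = \frac{9}{14}n^2\sigma(n)+\frac{5}{14}n^2\sigma_7(n) -108 \sum^{n-1}_{m=1}(4m^2-mn)\sigma(m)\sigma_5(n-m)$; (vii) $\tau(n) = \frac{8}{5}n^3\sigma(n)-\frac{3}{5}n^3\sigma_5(n) +96 \sum^{n-1}_{m=1}(7m^3-3m^2n)\sigma(m)\sigma_3(n-m)$;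 (viii) $\tau(n) = \frac{1}{2}n^2\sigma(n) + \frac{1}{2}n^2\sigma_5(n) - 12 \sum^{n-1}_{m=1}(36m^2-16 mn +n^2)\sigma(m)\sigma_5(n-m)$; (ix) $\tau(n) = n^3\sigma(n)- 24 \sum^{n-1}_{m=1}(21m^2n-28m^3-3mn^2)\sigma(m)\sigma_3(n-m)$.
   Context: $\tau(n)$ is Ramanujan's tau function, defined by $q\prod_{n\ge 1}(1-q^n)^{24} = \sum_{n\ge 1}\tau(n)q^n$. For $k\ge 1$, $\sigma_k(n)=\sum_{d\mid n} d^k$ (sum over positive divisors of $n$), and $\sigma(n)=\sigma_1(n)$. For $n=1$ the sum $\sum_{m=1}^{n-1}$ is empty and equals $0$. *)

(* Defs.v *)
From mathcomp Require Import all_boot all_order all_algebra.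
Set Implicit Arguments.
Unset Strict Implicit.
Unset Printing Implicit Defensive.
Import Order.TTheory GRing.Theory Num.Theory.
Local Open Scope ring_scope.

Definition sigma (k n : nat) : nat := (\sum_(d <- divisors n) d ^ k)%N.

Definition delta_trunc (N : nat) : {poly int} :=
  'X * \prod_(1 <= k < N.+1) (1 - 'X^k) ^+ 24.

(* The n-th coefficient of the infinite product q \prod_{k >= 1} (1 - q^k)^24:
   the factors with k > n do not affect it (see [tau_stable]). *)
Definition tau (n : nat) : int := (delta_trunc n)`_n.

Lemma coef_mul_1subXn_exp (p : {poly int}) (k e i : nat) :
  (i < k)%N -> (p * (1 - 'X^k) ^+ e)`_i = p`_i.
Proof.
move=> ltik; elim: e => [|e IHe]; first by rewrite expr0 mulr1.
by rewrite exprSr mulrA mulrBr mulr1 coefB coefMXn ltik subr0.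
Qed.

Lemma tau_stable (n N : nat) : (n <= N)%N -> (delta_trunc N)`_n = tau n.
Proof.
move/subnKC <-; elim: (N - n)%N => [|j IHj]; first by rewrite addn0.
rewrite -IHj /delta_trunc addnS big_nat_recr //= mulrA.
by rewrite coef_mul_1subXn_exp // ltnS leq_addr.
Qed.

(* Main.v *)
Require Import Defs.
From HB Require Import structures.
From mathcomp Require Import all_boot all_order all_algebra.
From mathcomp Require Import boolp zify ring lra.
Set Implicit Arguments.
Unset Strict Implicit.
Unset Printing Implicit Defensive.
Import Order.TTheory GRing.Theory Num.Theory.
Local Open Scope ring_scope.

(* Split the solutions of a x + b y = n in positive integers according to the sign of x - y; shearing
   (a, b, x, y) to (a + b, b, x, y - x) shows that, for h a polynomial in x^2 + x y + y^2 and
   (x y (x + y))^2, the sum of h(a, b) - h(-a, b) over all solutions reduces to power sums over the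
   divisors of n (Skoruppa).  This evaluates the convolutions of divisor functions that amount to
   Ramanujan's differential equations for E2, E4, E6 and to E8 = E4^2, E10 = E4 E6 and the relation of
   E12 with E4^3 and E6^2.  Both q prod (1 - q^k)^24 and E4^3 - E6^2 then satisfy theta f = E2 f, so
   they are proportional; each identity is the n-th coefficient of a differential polynomial identity
   expressing a multiple of E4^3 - E6^2. *)

(** * Solutions of a x + b y = n *)

Section Solutions.

Variables (V : nmodType) (n : nat).

Local Notation I := 'I_n.+1.
Local Notation quad := ((I * I) * (I * I))%type.

(** The quadruple is ((a, b), (x, y)). Positivity and a x + b y = n force every entry to be at most
    [n], so the finite index type loses no solution. *)
Definition sol (q : quad) : bool :=
  [&& 0 < q.1.1, 0 < q.1.2, 0 < q.2.1, 0 < q.2.2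
    & q.1.1 * q.2.1 + q.1.2 * q.2.2 == n]%N.

(** The identity a x + b y = (a - b) x + b (x + y) gives a bijection between the solutions with b <
    a and those with x < y. *)
Lemma sum_sol_shear (h : nat -> nat -> V) :
  \sum_(q : quad | sol q && (q.2.1 < q.2.2)%N) h q.1.1 q.1.2 =
  \sum_(q : quad | sol q && (q.1.2 < q.1.1)%N) h (q.1.1 - q.1.2)%N q.1.2.
Proof.
pose f (q : quad) : quad :=
  ((inord (q.1.1 - q.1.2), q.1.2), (q.2.1, inord (q.2.1 + q.2.2))).
pose g (q : quad) : quad :=
  ((inord (q.1.1 + q.1.2), q.1.2), (q.2.1, inord (q.2.2 - q.2.1))).
have subK (i j : I) : (inord (i - j) : I) = (i - j)%N :> nat.
   by rewrite inordK // ltnS (leq_trans (leq_subr _ _)) // -ltnS.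
have addK (i j : I) : (i + j <= n)%N -> (inord (i + j) : I) = (i + j)%N :> nat.
  by move=> le_n; rewrite inordK.
rewrite (reindex_onto f g) /=; last first.
  move=> [[a b] [x y]] /andP[/and5P[/= a0 b0 x0 y0 /eqP e] lt_xy].
  have le_ab : (a + b <= n)%N by nia.
  have le_n : (y <= n)%N by rewrite -ltnS.
  congr ((_, _), (_, _)); apply: val_inj => /=.
    by rewrite subK addK // addnK.
  by rewrite inordK subK ?subnKC // ltnW.
apply: eq_big => [[[a b] [x y]]|[[a b] [x y]] _]; last by rewrite /= subK.
rewrite /sol /=; apply/idP/idP.
  case/andP=> /andP[/and5P[]] /=; rewrite subK => ab0 b0 x0 y0 /eqP e lt_x _.
  (* If [x + y] exceeded [n], [inord] would return 0, against the assumption that this entry is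
     larger than [x]. *)
  have le_xy : (x + y <= n)%N.
    rewrite leqNgt; apply/negP => gt_n; move: lt_x; rewrite /inord /insubd.
    by rewrite insubF ?ltn0 //; apply/negbTE; rewrite -leqNgt.
  move: y0 lt_x e; rewrite addK // => y0 lt_x e.
  by apply/andP; split; [apply/and5P; split; try apply/eqP; nia | lia].
case/andP=> /and5P[a0 b0 x0 y0 /eqP e] lt_ba.
have le_xy : (x + y <= n)%N by nia.
rewrite subK addK //; apply/andP; split.
  by apply/andP; split; [apply/and5P; split; try apply/eqP; nia | lia].
apply/eqP; congr ((_, _), (_, _)); apply: val_inj => /=.
  by rewrite inordK subK ?subnK // ltnW.
by rewrite subK addK // addKn.
Qed.

Lemma sum_sol_swap (P : pred quad) (F : quad -> V) :
  \sum_(q | sol q && P q) F q =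
  \sum_(q | sol q && P ((q.1.2, q.1.1), (q.2.2, q.2.1)))
     F ((q.1.2, q.1.1), (q.2.2, q.2.1)).
Proof.
pose f (q : quad) : quad := ((q.1.2, q.1.1), (q.2.2, q.2.1)).
have fK : involutive f by case=> [[a b] [x y]].
rewrite (reindex_inj (inv_inj fK)) /=; apply: eq_bigl => -[[a b] [x y]] /=.
by rewrite /sol /= addnC andbCA; congr (_ && _); rewrite [X in _ && (_ && X)]andbCA.
Qed.

(** The swap (a, b, x, y) to (b, a, y, x) preserves solutions and exchanges the cases c.1 < c.2 and
    c.2 < c.1. The pair [c] is left open so as to compare either x with y or b with a. *)
Lemma sum_sol_symmetric (F : nat -> nat -> V) (c : quad -> nat * nat) :
    (forall a b, F a b = F b a) ->
    (forall q, c ((q.1.2, q.1.1), (q.2.2, q.2.1)) = ((c q).2, (c q).1)) ->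
  \sum_(q | sol q) F q.1.1 q.1.2 =
    (\sum_(q | sol q && ((c q).1 < (c q).2)%N) F q.1.1 q.1.2) *+ 2
    + \sum_(q | sol q && ((c q).1 == (c q).2)) F q.1.1 q.1.2.
Proof.
move=> FC cC; rewrite (bigID (fun q => (c q).1 == (c q).2)) /= addrC; congr (_ + _).
rewrite (bigID (fun q => ((c q).1 < (c q).2)%N)) /= mulr2n.
under eq_bigl do rewrite -andbA.
congr (_ + _).
  by apply: eq_bigl => q; case: ltngtP; rewrite ?andbF ?andbT.
under eq_bigl do rewrite -andbA.
rewrite (sum_sol_swap (fun q => ((c q).1 != (c q).2) && ~~ ((c q).1 < (c q).2)%N)
  (fun q => F q.1.1 q.1.2)).
apply: eq_big => [q|q _]; last exact: FC.
by rewrite cC /=; case: ltngtP; rewrite ?andbF ?andbT.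
Qed.

Lemma sum_sol_transpose (P : pred quad) (F : quad -> V) :
  \sum_(q | sol q && P q) F q = \sum_(q | sol q && P (q.2, q.1)) F (q.2, q.1).
Proof.
pose f (q : quad) : quad := (q.2, q.1).
have fK : involutive f by case.
rewrite (reindex_inj (inv_inj fK)) /=; apply: eq_bigl => -[[a b] [x y]] /=.
rewrite /sol /= mulnC [(y * b)%N]mulnC; congr (_ && _).
by case: (0 < x)%N (0 < a)%N (0 < b)%N (0 < y)%N => [] [] [] [].
Qed.

(** The bound [n] may exceed [k], so that the divisors of m and of n - m can be indexed by the same
    finite type. *)
Lemma sum_divisors_pairs (k : nat) (f : nat -> V) : (0 < k <= n)%N ->
  \sum_(d <- divisors k) f d =
  \sum_(p : I * I | [&& 0 < p.1, 0 < p.2 & p.1 * p.2 == k]%N) f p.1.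
Proof.
case/andP=> k0 le_kn.
have le_n d : (d %| k)%N -> (d < n.+1)%N.
  by move=> /dvdn_leq le_dk; rewrite ltnS (leq_trans (le_dk k0)).
rewrite (eq_bigl (fun p : I * I => (p.1 %| k)%N && (p.2 == inord (k %/ p.1)))).
  rewrite -(pair_big_dep (fun a : I => (a %| k)%N) (fun a x : I => x == inord (k %/ a))
     (fun a x : I => f a)) /=.
  transitivity (\sum_(0 <= a < n.+1 | (a %| k)%N) f a); last first.
    by rewrite big_mkord; apply: eq_bigr => i _; rewrite big_pred1_eq.
  rewrite -[RHS]big_filter.
  apply: perm_big; apply: uniq_perm; rewrite ?divisors_uniq ?filter_uniq ?iota_uniq //.
  move=> d; rewrite -dvdn_divisors // mem_filter mem_index_iota /=.
  by case: (boolP (d %| k)%N) => //= /le_n ->.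
case=> a x /=; apply/idP/idP.
  case/and3P=> a0 x0 /eqP <-; rewrite dvdn_mulr //=; apply/eqP/val_inj => /=.
  by rewrite mulKn // inordK.
case/andP=> dak /eqP ->.
have le_kd : (k %/ a <= k)%N by rewrite leq_div.
rewrite inordK ?ltnS ?(leq_trans le_kd) //.
have a0 : (0 < a)%N by rewrite (dvdn_gt0 k0 dak).
by rewrite a0 divn_gt0 // (dvdn_leq k0 dak) mulnC (divnK dak) eqxx.
Qed.

(** When x = y the equation is (a + b) x = n: put d = a + b, a divisor of [n] with x = n / d, and
    let a run from 1 to d - 1. *)
Lemma sum_sol_diag (k : nat -> nat -> nat -> V) : (0 < n)%N ->
  \sum_(q | sol q && (q.2.1 == q.2.2)) k q.1.1 q.1.2 q.2.1 =
  \sum_(d <- divisors n) \sum_(1 <= a < d) k a (d - a)%N (n %/ d)%N.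
Proof.
move=> n0.
pose P (p : I * I) := [&& 0 < p.1, 0 < p.2 & p.1 * p.2 == n]%N.
pose T (t : (I * I) * I) := P t.1 && (0 < t.2 < t.1.1)%N.
rewrite (@sum_divisors_pairs n (fun d => \sum_(1 <= a < d) k a (d - a)%N (n %/ d)%N));
  last by rewrite n0 leqnn.
transitivity (\sum_(t | T t) k t.2 (t.1.1 - t.2)%N t.1.2); last first.
  rewrite -(pair_big_dep P (fun (p : I * I) (a : I) => (0 < a < p.1)%N)
     (fun (p : I * I) (a : I) => k a (p.1 - a)%N p.2)) /=.
  apply: eq_bigr => -[d x] /and3P[/= d0 x0 /eqP e].
  have -> : (n %/ d = x)%N by rewrite -[X in (X %/ _)%N]e mulKn.
  rewrite (big_nat_widen _ _ n.+1) ?(ltnW (ltn_ord d)) // big_geq_mkord.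
  by apply: eq_bigl => a; rewrite andbC.
pose f (t : (I * I) * I) : quad := ((t.2, inord (t.1.1 - t.2)), (t.1.2, t.1.2)).
pose g (q : quad) : (I * I) * I := ((inord (q.1.1 + q.1.2), q.2.1), q.1.1).
have subK (i j : I) : (inord (i - j) : I) = (i - j)%N :> nat.
  by rewrite inordK // ltnS (leq_trans (leq_subr _ _)) // -ltnS.
rewrite (reindex_onto f g) /=; last first.
  move=> [[a b] [x y]] /andP[/and5P[/= a0 b0 x0 y0 /eqP e] /eqP exy].
  have le_ab : (a + b <= n)%N by move: e; rewrite -exy; nia.
  rewrite /f /g /= -exy inordK //; congr ((_, _), (_, _)); apply: val_inj => /=.
  by rewrite inordK addKn.
apply: eq_big => [[[d x] a]|[[d x] a] _]; last by rewrite /= subK.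
rewrite /sol /T /P /= eqxx andbT; apply/idP/idP.
  case/andP=> /and5P[a0 da0 x0 _ /eqP e] _; move: da0 e; rewrite subK => da0 e.
  have ed : (a + (d - a) = d)%N by rewrite subnKC // ltnW // -subn_gt0.
  apply/andP; split; last by lia.
  by apply/and3P; split=> //; [lia | rewrite -{1}ed mulnDl e].
case/andP=> /and3P[d0 x0 /eqP e] /andP[a0 lt_ad].
rewrite subK -mulnDl (subnKC (ltnW lt_ad)) e eqxx a0 x0 subn_gt0 lt_ad /=.
by apply/eqP; congr ((_, _), _); apply: val_inj; rewrite /= subK (subnKC (ltnW lt_ad)) inordK.
Qed.

Lemma sum_divisors_div (f : nat -> nat -> V) : (0 < n)%N ->
  \sum_(d <- divisors n) f d (n %/ d)%N = \sum_(d <- divisors n) f (n %/ d)%N d.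
Proof.
move=> n0; have nn : (0 < n <= n)%N by rewrite n0 leqnn.
rewrite (sum_divisors_pairs (fun d => f d (n %/ d)%N) nn).
rewrite (sum_divisors_pairs (fun d => f (n %/ d)%N d) nn).
have swapK : involutive (fun p : I * I => (p.2, p.1)) by case.
rewrite (reindex_inj (inv_inj swapK)) /=; apply: eq_big => [[x d]|[x d]] /=.
  by rewrite andbCA mulnC.
case/and3P=> d0 x0 /eqP e.
have -> : (n %/ d = x)%N by rewrite -[X in (X %/ _)%N]e mulKn.
by have -> : (n %/ x = d)%N by rewrite -[X in (X %/ _)%N]e mulnK.
Qed.

End Solutions.

(** Solutions are grouped by the value m = a x; the rest of the equation is b y = n - m, so each
    group is a product of two sets of factorisations. *)
Lemma sum_sol_mul (R : nzSemiRingType) (n : nat) (f g : nat -> R) :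
  \sum_(q | sol q) f (q.1.1 : 'I_n.+1) * g q.1.2 =
  \sum_(1 <= m < n)
     (\sum_(d <- divisors m) f d) * (\sum_(d <- divisors (n - m)) g d).
Proof.
pose I := 'I_n.+1.
pose P m (p : I * I) := [&& 0 < p.1, 0 < p.2 & p.1 * p.2 == m]%N.
rewrite (big_nat_widen _ _ n.+1) ?leqnSn // big_geq_mkord.
rewrite (partition_big (fun q : (I * I) * (I * I) => inord (q.1.1 * q.2.1) : I)
   (fun m : I => (m < n) && (0 < m))%N) /=; last first.
  move=> [[a b] [x y]] /and5P[/= a0 b0 x0 y0 /eqP e].
  have lt_n : (a * x < n)%N by nia.
  by rewrite inordK ?lt_n ?muln_gt0 ?a0 // ltnW.
apply: eq_bigr => m /andP[lt_mn m0].
rewrite (sum_divisors_pairs (n := n)); last by rewrite m0 ltnW.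
rewrite (sum_divisors_pairs (n := n)); last by rewrite subn_gt0 lt_mn leq_subr.
rewrite big_distrlr /= (pair_big (P m) (P (n - m)%N)
  (fun p r : I * I => f p.1 * g r.1)) /=.
pose t (u : (I * I) * (I * I)) := ((u.1.1, u.2.1), (u.1.2, u.2.2)).
have tK : involutive t by case=> [[? ?] [? ?]].
rewrite (reindex_inj (inv_inj tK)) /=; apply: eq_bigl => -[[a x] [b y]].
rewrite /sol /P /=; apply/idP/idP.
  case/andP=> /and5P[a0 b0 x0 y0 /eqP e] /eqP em.
  have le_n : (a * x < n.+1)%N by nia.
  move: (congr1 val em); rewrite /= inordK // => eax.
  by rewrite a0 b0 x0 y0 -eax eqxx /= -[X in (X - _)%N]e addKn.
case/andP=> /and3P[a0 x0 /eqP e1] /and3P[b0 y0 /eqP e2].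
rewrite a0 b0 x0 y0 e1 e2 (subnKC (ltnW lt_mn)) eqxx /=.
by apply/eqP/val_inj; rewrite /= inordK.
Qed.

(** The sum of h(a, b) is split by comparing x with y, that of h(- a, b) by comparing b with a. The
    off-diagonal parts cancel; the diagonals x = y and a = b give the two terms on the right. *)
Lemma sum_sol_invariant (n : nat) (h : rat -> rat -> rat) : (0 < n)%N ->
    (forall x y, h x y = h y x) -> (forall x y, h (- x) (- y) = h x y) ->
    (forall x y, h (x - y) y = h (- x) y) ->
  \sum_(q | sol q) (h (q.1.1 : 'I_n.+1)%:R q.1.2%:R - h (- q.1.1%:R) q.1.2%:R) =
  \sum_(d <- divisors n) (\sum_(1 <= a < d) h a%:R (d%:R - a%:R)
     - ((n %/ d)%:R - 1) * h 0 d%:R).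
Proof.
move=> n0 hC hN hS; rewrite !sumrB.
pose H (a b : nat) := h a%:R b%:R.
pose U (a b : nat) := h (- a%:R) b%:R.
have UC a b : U a b = U b a by rewrite /U -hN opprK hC.
pose Fx (q : ('I_n.+1 * 'I_n.+1) * ('I_n.+1 * 'I_n.+1)) := (nat_of_ord q.2.1, nat_of_ord q.2.2).
pose Fa (q : ('I_n.+1 * 'I_n.+1) * ('I_n.+1 * 'I_n.+1)) := (nat_of_ord q.1.2, nat_of_ord q.1.1).
rewrite (sum_sol_symmetric (F := H) (c := Fx)) //; last by move=> a b; apply: hC.
rewrite (sum_sol_symmetric (F := U) (c := Fa)) //.
(* The shear turns h(a, b) into h(a - b, b), which is h(- a, b) by invariance. *)
have -> : \sum_(q | sol q && ((Fx q).1 < (Fx q).2)%N) H q.1.1 q.1.2 =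
          \sum_(q | sol q && ((Fa q).1 < (Fa q).2)%N) U q.1.1 q.1.2.
  rewrite (sum_sol_shear n H); apply: eq_bigr => -[[a b] [x y]] /andP[_ /= lt_ba].
  by rewrite /H /U natrB 1?ltnW // hS.
rewrite [X in X - _]addrC addrKA.
rewrite (sum_sol_diag (fun a b _ => H a b)) //.
(* For a = b invariance gives h(- a, a) = h(0, a); exchanging (a, b) with (x, y) brings this to the
   diagonal x = y. *)
have -> : \sum_(q | sol q && ((Fa q).1 == (Fa q).2)) U q.1.1 q.1.2 =
          \sum_(q | @sol n q && (q.2.1 == q.2.2)) h 0 (q.2.1)%:R.
  rewrite (sum_sol_transpose (fun q => (Fa q).1 == (Fa q).2)).
  apply: eq_big => [q|[[a b] [x y]] /andP[_ /= /eqP <-]]; first by rewrite eq_sym.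
  by rewrite /U -hS subrr.
rewrite (sum_sol_diag (fun _ _ x => h 0 x%:R)) //.
congr (_ - _).
  apply: eq_bigr => d _; apply: eq_big_nat => a /andP[_ lt_ad].
  by rewrite /H natrB // ltnW.
(* The value n / d is taken d - 1 times; exchanging d with n / d gives the stated weights. *)
transitivity (\sum_(d <- divisors n) (d%:R - 1) * h 0 (n %/ d)%:R).
  rewrite !big_seq; apply: eq_bigr => d; rewrite -dvdn_divisors // => dn.
  rewrite big_const_nat iter_addr_0 -[LHS]mulr_natl natrB //.
  exact: dvdn_gt0 dn.
exact: (sum_divisors_div (fun d e => (d%:R - 1) * h 0 e%:R)).
Qed.

Lemma sum_mirror_pow (d : nat) (c0 c1 c2 c3 c4 : rat) : (0 < d)%N ->
  let D : rat := d%:R in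
  \sum_(1 <= a < d) (c0 + c1 * (a%:R * (D - a%:R)) + c2 * (a%:R * (D - a%:R)) ^+ 2
    + c3 * (a%:R * (D - a%:R)) ^+ 3 + c4 * (a%:R * (D - a%:R)) ^+ 4) =
  c0 * (D - 1) + c1 * (D ^+ 3 - D) / 6 + c2 * (D ^+ 5 - D) / 30
  + c3 * (3 * D ^+ 7 + 7 * D ^+ 3 - 10 * D) / 420
  + c4 * (D ^+ 9 + 20 * D ^+ 3 - 21 * D) / 630.
Proof.
case: d => // m _ D; pose u (a : nat) : rat := a%:R * (D - a%:R).
(* [S1] to [S8] are Faulhaber's polynomials for the sums of the first to eighth powers. *)
pose S1 (x : rat) := x * (x + 1) / 2.
pose S2 (x : rat) := x / 6 + x ^+ 2 / 2 + x ^+ 3 / 3.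
pose S3 (x : rat) := x ^+ 2 / 4 + x ^+ 3 / 2 + x ^+ 4 / 4.
pose S4 (x : rat) := - x / 30 + x ^+ 3 / 3 + x ^+ 4 / 2 + x ^+ 5 / 5.
pose S5 (x : rat) := - x ^+ 2 / 12 + 5 * x ^+ 4 / 12 + x ^+ 5 / 2 + x ^+ 6 / 6.
pose S6 (x : rat) := x / 42 - x ^+ 3 / 6 + x ^+ 5 / 2 + x ^+ 6 / 2 + x ^+ 7 / 7.
pose S7 (x : rat) := x ^+ 2 / 12 - 7 * x ^+ 4 / 24 + 7 * x ^+ 6 / 12 + x ^+ 7 / 2 + x ^+ 8 / 8.
pose S8 (x : rat) := - x / 30 + 2 * x ^+ 3 / 9 - 7 * x ^+ 5 / 15 + 2 * x ^+ 7 / 3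
  + x ^+ 8 / 2 + x ^+ 9 / 9.
(* [D] stays fixed during the induction on the upper bound, which is set to D - 1 only at the
   end. *)
have sum1 k : \sum_(1 <= a < k.+1) u a = D * S1 k%:R - S2 k%:R.
  elim: k => [|k IH]; first by rewrite big_geq // /S1 /S2
    !expr0n !(mul0r, mulr0, oppr0, addr0, subr0).
  by rewrite big_nat_recr //= IH /u /S1 /S2 -[k.+1%:R]natr1; field.
have sum2 k : \sum_(1 <= a < k.+1) u a ^+ 2 =
    D ^+ 2 * S2 k%:R - 2 * D * S3 k%:R + S4 k%:R.
  elim: k => [|k IH]; first by rewrite big_geq // /S2 /S3 /S4
    !expr0n !(mul0r, mulr0, oppr0, addr0, subr0).
  by rewrite big_nat_recr //= IH /u /S2 /S3 /S4 -[k.+1%:R]natr1; field.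
have sum3 k : \sum_(1 <= a < k.+1) u a ^+ 3 =
    D ^+ 3 * S3 k%:R - 3 * D ^+ 2 * S4 k%:R + 3 * D * S5 k%:R - S6 k%:R.
  elim: k => [|k IH]; first by rewrite big_geq // /S3 /S4 /S5 /S6
    !expr0n !(mul0r, mulr0, oppr0, addr0, subr0).
  by rewrite big_nat_recr //= IH /u /S3 /S4 /S5 /S6 -[k.+1%:R]natr1; field.
have sum4 k : \sum_(1 <= a < k.+1) u a ^+ 4 =
    D ^+ 4 * S4 k%:R - 4 * D ^+ 3 * S5 k%:R + 6 * D ^+ 2 * S6 k%:R
    - 4 * D * S7 k%:R + S8 k%:R.
  elim: k => [|k IH]; first by rewrite big_geq // /S4 /S5 /S6 /S7 /S8
    !expr0n !(mul0r, mulr0, oppr0, addr0, subr0).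
  by rewrite big_nat_recr //= IH /u /S4 /S5 /S6 /S7 /S8 -[k.+1%:R]natr1; field.
rewrite !big_split /= -!mulr_sumr -!/(u _) sum1 sum2 sum3 sum4.
rewrite sumr_const_nat subSS subn0 -mulr_natr.
have -> : D = m%:R + 1 by rewrite natr1.
by rewrite /S1 /S2 /S3 /S4 /S5 /S6 /S7 /S8; field.
Qed.

(** * Convolutions of divisor sums *)

Definition sigma_conv (i j n : nat) : rat :=
  \sum_(1 <= m < n) (sigma i m)%:R * (sigma j (n - m))%:R.

Lemma natr_sigma (k n : nat) : (sigma k n)%:R = \sum_(d <- divisors n) d%:R ^+ k :> rat.
Proof. by rewrite natr_sum; apply: eq_bigr => d _; rewrite natrX. Qed.

Lemma sum_sol_pow (i j n : nat) :
  \sum_(q | sol q) (q.1.1 : 'I_n.+1)%:R ^+ i * q.1.2%:R ^+ j = sigma_conv i j n.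
Proof.
rewrite (sum_sol_mul n (fun a => a%:R ^+ i) (fun b => b%:R ^+ j : rat)).
by apply: eq_bigr => m _; rewrite !natr_sigma.
Qed.

Lemma sigma_convC (i j n : nat) : sigma_conv i j n = sigma_conv j i n.
Proof.
rewrite /sigma_conv big_nat_rev /= add1n.
by apply: eq_big_nat => m /andP[m0 lt_mn]; rewrite subSS subKn ?(ltnW lt_mn) // mulrC.
Qed.

Section Convolutions.

Variables (n : nat) (n_gt0 : (0 < n)%N).

Local Notation s k := ((sigma k n)%:R : rat).
Local Notation N := (n%:R : rat).

(* Up to sign, the polynomials e2^i e3^(2j) in the elementary symmetric functions of (x, y, - x - y). *)
Definition S3_form (i j : nat) (x y : rat) : rat :=
  (x ^+ 2 + x * y + y ^+ 2) ^+ i * ((x * y * (x + y)) ^+ 2) ^+ j.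

(** On the diagonal, y = D - x and u = x y give x^2 + x y + y^2 = D^2 - u and x y (x + y) = u D, so
    the form is a polynomial in u with coefficients depending on D. The factor [0 ^+ j] records that
    the form vanishes at x = 0 unless j = 0. *)
Lemma sum_sol_S3_form (i j : nat) (c0 c1 c2 c3 c4 : rat -> rat) : (0 < i + j)%N ->
    (forall D u : rat, (D ^+ 2 - u) ^+ i * ((u * D) ^+ 2) ^+ j =
       c0 D + c1 D * u + c2 D * u ^+ 2 + c3 D * u ^+ 3 + c4 D * u ^+ 4) ->
  \sum_(q | sol q) (S3_form i j (q.1.1 : 'I_n.+1)%:R q.1.2%:R
                    - S3_form i j (- q.1.1%:R) q.1.2%:R) =
  \sum_(d <- divisors n) let D : rat := d%:R in
    (c0 D * (D - 1) + c1 D * (D ^+ 3 - D) / 6 + c2 D * (D ^+ 5 - D) / 30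
     + c3 D * (3 * D ^+ 7 + 7 * D ^+ 3 - 10 * D) / 420
     + c4 D * (D ^+ 9 + 20 * D ^+ 3 - 21 * D) / 630
     - (N * D ^+ (2 * i).-1 - D ^+ (2 * i)) * 0 ^+ j).
Proof.
move=> ij_gt0 cE; rewrite sum_sol_invariant //; first last.
- move=> x y; rewrite /S3_form; congr (_ ^+ _ * _ ^+ _); ring.
- move=> x y; rewrite /S3_form; congr (_ ^+ _ * _ ^+ _); ring.
- move=> x y; rewrite /S3_form; congr (_ ^+ _ * _ ^+ _); ring.
rewrite big_seq [RHS]big_seq; apply: eq_bigr => d; rewrite -dvdn_divisors // => dn.
have d_gt0 := dvdn_gt0 n_gt0 dn.
have := sum_mirror_pow (c0 d%:R) (c1 d%:R) (c2 d%:R) (c3 d%:R) (c4 d%:R) d_gt0.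
move=> E; apply: congr2; first apply: (etrans _ E).
- by apply: eq_bigr => a _; rewrite -cE /S3_form; congr (_ ^+ _ * _ ^+ _); ring.
congr (- _); rewrite /S3_form expr0n mul0r addr0 !add0r mul0r exprM.
(* For j = 0 the quotient n / d is absorbed through n = (n / d) d, which lowers the exponent of d by
   one. *)
case: j ij_gt0 {cE E} => [|j _]; last by rewrite [in LHS]exprS !expr0n !(mul0r, mulr0).
rewrite addn0 => i_gt0; rewrite !expr0 !mulr1 mulrBl mul1r; congr (_ - _).
rewrite -exprM -[in RHS](divnK dn) natrM -mulrA -exprS prednK //.
by rewrite muln_gt0.
Qed.

(** A polynomial in d is given by its pairs (coefficient, exponent); the coefficients may involve
    [n]. *)
Lemma sum_divisors_poly (cs : seq (rat * nat)) :
  \sum_(d <- divisors n) (\sum_(p <- cs) p.1 * d%:R ^+ p.2) =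
  \sum_(p <- cs) p.1 * s p.2.
Proof.
rewrite exchange_big /=; apply: eq_bigr => p _.
by rewrite natr_sigma mulr_sumr.
Qed.

Tactic Notation "sum_over_divisors" uconstr(cs) :=
  refine (etrans _ (etrans (sum_divisors_poly cs) _));
  last (by rewrite !big_cons big_nil /=; lra);
  let d := fresh "d" in let D := fresh "D" in apply: eq_bigr => d _;
  rewrite !big_cons big_nil /=; move: (d%:R : rat) => D; lra.

Ltac sum_over_solutions :=
  rewrite -?sum_sol_pow ?mulr_sumr -?big_split /=;
  let q := fresh "q" in
  apply: eq_bigr => q _; rewrite /S3_form; ring.

(** In this and the following evaluations the left-hand side is h(a, b) - h(- a, b) in monomials;
    for h = x^2 + x y + y^2 it is 2 a b. *)
Lemma sigma_conv11 :
  2 * sigma_conv 1 1 n = 5 / 6 * s 3 + (1 / 6 - N) * s 1.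
Proof.
transitivity (\sum_(q | sol q) (S3_form 1 0 (q.1.1 : 'I_n.+1)%:R q.1.2%:R
    - S3_form 1 0 (- q.1.1%:R) q.1.2%:R)).
  symmetry; sum_over_solutions.
rewrite (@sum_sol_S3_form 1 0
  (fun D => D ^+ 2) (fun=> -1) (fun=> 0) (fun=> 0) (fun=> 0) isT);
  last by move=> D u; cbv beta; ring.
sum_over_divisors [:: (5 / 6, 3%N); (1 / 6 - N, 1%N)].
Qed.

Lemma sigma_conv13 :
  8 * sigma_conv 1 3 n = 7 / 10 * s 5 + (1 / 3 - N) * s 3 + (- 1 / 30) * s 1.
Proof.
transitivity (\sum_(q | sol q) (S3_form 2 0 (q.1.1 : 'I_n.+1)%:R q.1.2%:R
    - S3_form 2 0 (- q.1.1%:R) q.1.2%:R)).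
  have -> : 8 * sigma_conv 1 3 n = 4 * sigma_conv 1 3 n + 4 * sigma_conv 3 1 n
    by rewrite (sigma_convC 3 1); ring.
  symmetry; sum_over_solutions.
rewrite (@sum_sol_S3_form 2 0
  (fun D => D ^+ 4) (fun D => - 2 * D ^+ 2) (fun=> 1) (fun=> 0) (fun=> 0) isT);
  last by move=> D u; cbv beta; ring.
sum_over_divisors [:: (7 / 10, 5%N); (1 / 3 - N, 3%N); (- 1 / 30, 1%N)].
Qed.

Lemma sigma_conv33 :
  4 * sigma_conv 3 3 n = 1 / 30 * s 7 + (- 1 / 30) * s 3.
Proof.
transitivity (\sum_(q | sol q) (S3_form 0 1 (q.1.1 : 'I_n.+1)%:R q.1.2%:R
    - S3_form 0 1 (- q.1.1%:R) q.1.2%:R)).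
  symmetry; sum_over_solutions.
rewrite (@sum_sol_S3_form 0 1
  (fun=> 0) (fun=> 0) (fun D => D ^+ 2) (fun=> 0) (fun=> 0) isT);
  last by move=> D u; cbv beta; ring.
sum_over_divisors [:: (1 / 30, 7%N); (- 1 / 30, 3%N)].
Qed.

(** The cube of x^2 + x y + y^2 contributes 6 (a^5 b + a b^5) + 14 a^3 b^3, so two convolutions
    occur; the second is known from [sigma_conv33]. *)
Lemma sigma_conv15_33 :
  12 * sigma_conv 1 5 n + 14 * sigma_conv 3 3 n =
    83 / 140 * s 7 + (1 / 2 - N) * s 5 + (- 7 / 60) * s 3 + 1 / 42 * s 1.
Proof.
transitivity (\sum_(q | sol q) (S3_form 3 0 (q.1.1 : 'I_n.+1)%:R q.1.2%:R
    - S3_form 3 0 (- q.1.1%:R) q.1.2%:R)).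
  have -> : 12 * sigma_conv 1 5 n = 6 * sigma_conv 1 5 n + 6 * sigma_conv 5 1 n
    by rewrite (sigma_convC 5 1); ring.
  symmetry; sum_over_solutions.
rewrite (@sum_sol_S3_form 3 0
  (fun D => D ^+ 6) (fun D => - 3 * D ^+ 4) (fun D => 3 * D ^+ 2) (fun=> -1) (fun=> 0) isT);
  last by move=> D u; cbv beta; ring.
sum_over_divisors [:: (83 / 140, 7%N); (1 / 2 - N, 5%N); (- 7 / 60, 3%N); (1 / 42, 1%N)].
Qed.

Lemma sigma_conv35 :
  12 * sigma_conv 3 5 n = 11 / 420 * s 9 + (- 1 / 20) * s 5 + 1 / 42 * s 3.
Proof.
transitivity (\sum_(q | sol q) (S3_form 1 1 (q.1.1 : 'I_n.+1)%:R q.1.2%:R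
    - S3_form 1 1 (- q.1.1%:R) q.1.2%:R)).
  have -> : 12 * sigma_conv 3 5 n = 6 * sigma_conv 3 5 n + 6 * sigma_conv 5 3 n
    by rewrite (sigma_convC 5 3); ring.
  symmetry; sum_over_solutions.
rewrite (@sum_sol_S3_form 1 1
  (fun=> 0) (fun=> 0) (fun D => D ^+ 4) (fun D => - D ^+ 2) (fun=> 0) isT);
  last by move=> D u; cbv beta; ring.
sum_over_divisors [:: (11 / 420, 9%N); (- 1 / 20, 5%N); (1 / 42, 3%N)].
Qed.

(** The two convolutions belong to E4 E8 and E6^2, of weight 12; this is the combination in which
    the cusp form cancels and only divisor sums remain. *)
Lemma sigma_conv37_55 :
  16 * sigma_conv 3 7 n + 20 * sigma_conv 5 5 n =
    13 / 630 * s 11 + (- 1 / 15) * s 7 + 5 / 63 * s 5 + (- 1 / 30) * s 3.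
Proof.
transitivity (\sum_(q | sol q) (S3_form 2 1 (q.1.1 : 'I_n.+1)%:R q.1.2%:R
    - S3_form 2 1 (- q.1.1%:R) q.1.2%:R)).
  have -> : 16 * sigma_conv 3 7 n = 8 * sigma_conv 3 7 n + 8 * sigma_conv 7 3 n
    by rewrite (sigma_convC 7 3); ring.
  symmetry; sum_over_solutions.
rewrite (@sum_sol_S3_form 2 1
  (fun=> 0) (fun=> 0) (fun D => D ^+ 6) (fun D => - 2 * D ^+ 4) (fun D => D ^+ 2) isT);
  last by move=> D u; cbv beta; ring.
sum_over_divisors [:: (13 / 630, 11%N); (- 1 / 15, 7%N); (5 / 63, 5%N); (- 1 / 30, 3%N)].
Qed.

End Convolutions.

(** * Formal power series *)

(** The wrapper gives series a type of their own, whose product is the Cauchy product. *)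
Record fps (R : Type) := Fps { fps_coef :> nat -> R }.

Lemma fpsP (R : Type) (f g : fps R) : (forall n, f n = g n) -> f = g.
Proof. by case: f g => [f] [g] /= /funext ->. Qed.

HB.instance Definition _ (R : Type) := gen_eqMixin (fps R).
HB.instance Definition _ (R : Type) := gen_choiceMixin (fps R).

Section PowerSeries.

Variable R : comNzRingType.

Implicit Types f g h : fps R.

Definition fps_add f g := Fps (fun n => f n + g n).
Definition fps_opp f := Fps (fun n => - f n).
Definition fps_mul f g := Fps (fun n => \sum_(i < n.+1) f i * g (n - i)%N).
Definition fps_one : fps R := Fps (fun n => (n == 0%N)%:R).

Fact fps_addA : associative fps_add.
Proof. by move=> f g h; apply: fpsP => n; apply: addrA. Qed.

Fact fps_addC : commutative fps_add.
Proof. by move=> f g; apply: fpsP => n; apply: addrC. Qed.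

Fact fps_add0 : left_id (Fps (fun=> 0)) fps_add.
Proof. by move=> f; apply: fpsP => n; apply: add0r. Qed.

Fact fps_addN : left_inverse (Fps (fun=> 0)) fps_opp fps_add.
Proof. by move=> f; apply: fpsP => n; apply: addNr. Qed.

HB.instance Definition _ :=
  GRing.isZmodule.Build (fps R) fps_addA fps_addC fps_add0 fps_addN.

(* Truncation transfers the associativity and commutativity of the product from polynomials. *)
Definition fps_trunc (n : nat) f : {poly R} := \poly_(i < n.+1) f i.

Lemma fps_mul_trunc n f g i : (i <= n)%N ->
  fps_mul f g i = (fps_trunc n f * fps_trunc n g)`_i.
Proof.
move=> le_in; rewrite coefM; apply: eq_bigr => j _.
have le_jn : (j <= n)%N by rewrite (leq_trans _ le_in) // -ltnS.
by rewrite !coef_poly !ltnS le_jn (leq_trans (leq_subr _ _) le_in).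
Qed.

Fact fps_mulC : commutative fps_mul.
Proof.
by move=> f g; apply: fpsP => n; rewrite !(fps_mul_trunc _ _ (leqnn n)) mulrC.
Qed.

Fact fps_mulA : associative fps_mul.
Proof.
move=> f g h; apply: fpsP => n.
transitivity ((fps_trunc n f * (fps_trunc n g * fps_trunc n h))`_n).
  rewrite coefM; apply: eq_bigr => i _.
  by rewrite coef_poly ltn_ord (fps_mul_trunc _ _ (leq_subr _ _)).
rewrite mulrA coefM; apply: eq_bigr => i _.
rewrite coef_poly ltnS leq_subr (@fps_mul_trunc n) //.
by rewrite -ltnS.
Qed.

Fact fps_mul1 : left_id fps_one fps_mul.
Proof.
move=> f; apply: fpsP => n; rewrite /= big_ord_recl /= mul1r subn0.
by rewrite big1 ?addr0 // => i _; rewrite mul0r.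
Qed.

Fact fps_mulDl : left_distributive fps_mul fps_add.
Proof.
move=> f g h; apply: fpsP => n; rewrite /= -big_split /=.
by apply: eq_bigr => i _; rewrite mulrDl.
Qed.

Fact fps_one_neq0 : fps_one != Fps (fun=> 0).
Proof.
by apply/eqP => /(congr1 (fun f : fps R => f 0%N)) /= /eqP; rewrite oner_eq0.
Qed.

HB.instance Definition _ := GRing.Zmodule_isComNzRing.Build (fps R)
  fps_mulA fps_mulC fps_mul1 fps_mulDl fps_one_neq0.

Lemma fpsD f g n : (f + g) n = f n + g n. Proof. by []. Qed.

Lemma fpsN f n : (- f) n = - f n. Proof. by []. Qed.

Lemma fpsB f g n : (f - g) n = f n - g n. Proof. by []. Qed.

Lemma fps1 n : (1 : fps R) n = (n == 0%N)%:R. Proof. by []. Qed.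

Lemma fpsM f g n : (f * g) n = \sum_(i < n.+1) f i * g (n - i)%N. Proof. by []. Qed.

Lemma fpsMn f k n : (f *+ k) n = f n *+ k.
Proof. by elim: k => [|k IHk] //; rewrite !mulrS fpsD IHk. Qed.

Lemma fps_natM k f n : (k%:R * f) n = k%:R * f n.
Proof. by rewrite !mulr_natl fpsMn. Qed.

Lemma fps_sum (I : Type) (r : seq I) (P : pred I) (F : I -> fps R) n :
  (\sum_(i <- r | P i) F i) n = \sum_(i <- r | P i) F i n.
Proof. by elim/big_rec2: _ => // i x f _ <-. Qed.

(* The derivation q d/dq. *)
Definition theta f := Fps (fun n => n%:R * f n).

Lemma thetaE f n : theta f n = n%:R * f n. Proof. by []. Qed.

Lemma thetaD f g : theta (f + g) = theta f + theta g.
Proof. by apply: fpsP => n; rewrite !(thetaE, fpsD) mulrDr. Qed.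

Lemma thetaN f : theta (- f) = - theta f.
Proof. by apply: fpsP => n; rewrite !(thetaE, fpsN) mulrN. Qed.

Lemma theta_nat k : theta k%:R = 0.
Proof.
apply: fpsP => -[|n]; first by rewrite thetaE mul0r.
by rewrite thetaE fpsMn fps1 mul0rn mulr0.
Qed.

Lemma theta1 : theta 1 = 0.
Proof. exact: (theta_nat 1). Qed.

Lemma thetaM f g : theta (f * g) = theta f * g + f * theta g.
Proof.
apply: fpsP => n; rewrite thetaE fpsD !fpsM mulr_sumr -big_split /=.
apply: eq_bigr => i _; have -> : n%:R = i%:R + (n - i)%:R :> R.
  by rewrite -natrD subnKC // -ltnS.
by rewrite mulrDl mulrA mulrCA.
Qed.

End PowerSeries.

(* Otherwise rewriting with the coefficient lemmas unfolds the ring operations and then the numerals. *)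
#[global] Opaque fps_add fps_opp fps_mul fps_one.

(** * Eisenstein series *)

(** Deduces an equation from [k] times a known one, leaving a polynomial identity for [ring]. *)
Lemma eq_lincomb (R : pzRingType) (k x y a b : R) :
  x = y -> a - b = k * (x - y) -> a = b.
Proof. by move=> ->; rewrite subrr mulr0 => /subr0_eq. Qed.

(* The ring generated by E2 and the derivatives b = - E2' / 24 and c = b' contains E4 and E6 and is
   closed under the derivation, with integral structure constants; [Dc] is Chazy's equation for E2. *)
Section ChazyDerivation.

Variables (S : comNzRingType) (D : S -> S).
Hypothesis DD : forall x y, D (x + y) = D x + D y.
Hypothesis DN : forall x, D (- x) = - D x.
Hypothesis DM : forall x y, D (x * y) = D x * y + x * D y.

Lemma derivation0 : D 0 = 0.
Proof. by apply: (addrI (D 0)); rewrite addr0 -DD addr0. Qed.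

Lemma derivation_nat (k : nat) : D k%:R = 0.
Proof.
have D1 : D 1 = 0.
  by apply: (addrI (D 1)); rewrite addr0 -{3}[1]mulr1 DM mulr1 mul1r.
by elim: k => [|k IHk]; [exact: derivation0 | rewrite mulrS DD D1 IHk addr0].
Qed.

Variables E2 E4 E6 b c : S.
Hypothesis E4E : E4 = E2 ^+ 2 + 288 * b.
Hypothesis E6E : E6 = E2 ^+ 3 + 432 * E2 * b - 864 * c.
Hypothesis DE2 : D E2 = - 24 * b.
Hypothesis Db : D b = c.

Let D0 := derivation0.
Let Dconst := derivation_nat.

(** Substituting [E6E] and [E4E] makes [D c] appear with coefficient -1728. The factor remains since
    [S] is an arbitrary ring. *)
Lemma chazy_of_ramanujan : 2 * D E6 = E2 * E6 - E4 ^+ 2 ->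
  1728 * D c = 1728 * (E2 * c + 36 * b ^+ 2).
Proof.
move=> DE6; apply: (eq_lincomb (k := -1) DE6).
by rewrite E6E E4E !(Dconst, DN, DD, DM) DE2 Db; ring.
Qed.

Hypothesis Dc : D c = E2 * c + 36 * b ^+ 2.

Lemma derivation_E4 : D E4 = - 48 * E2 * b + 288 * c.
Proof. by rewrite E4E !(Dconst, DD, DM) DE2 Db; ring. Qed.

Lemma derivation_E6 : D E6 = - 72 * E2 ^+ 2 * b - 432 * E2 * c - 144 * 288 * b ^+ 2.
Proof. by rewrite E6E !(Dconst, DN, DD, DM) DE2 Db Dc; ring. Qed.

Ltac derivation_ring :=
  rewrite ?(Dconst, D0, derivation_E4, derivation_E6, DE2, Db, Dc, DN, DD, DM) E6E E4E; ring.

(** In Ramanujan's terms: 3 E4^2 E4' - 2 E6 E6' = E4^2 (E2 E4 - E6) - E6 (E2 E6 - E4^2), where the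
    mixed terms cancel. *)
Lemma derivation_cusp : D (E4 ^+ 3 - E6 ^+ 2) = E2 * (E4 ^+ 3 - E6 ^+ 2).
Proof. derivation_ring. Qed.

(** Here E4^3 and E6^2 do not occur through their difference; the relation with E12 is needed as
    well to isolate it. *)
Lemma cusp_relation_i : 5 * (E2 * (E4 * E6)) = 6 * D (E4 * E6) + 2 * E6 ^+ 2 + 3 * E4 ^+ 3.
Proof. derivation_ring. Qed.

(** In this and the later relations, once [b] is theta of the series of sigma, the factors [b], [c],
    [D c] produce the weights m, m^2, m^3 in the convolution, and each outer [D] a factor n. *)
Lemma cusp_relation_ii : 8 * (E4 ^+ 3 - E6 ^+ 2) =
  54 * D (E4 * E6) + 45 * D (D (E4 ^+ 2)) + 80 * (81 * (b * E4 ^+ 2)).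
Proof. derivation_ring. Qed.

Lemma cusp_relation_iii : 49 * (E4 ^+ 3 - E6 ^+ 2) = 216 * D (D (D E6))
  + 252 * D (D (E4 ^+ 2)) + 252 * (288 * (c * E6)).
Proof. derivation_ring. Qed.

Lemma cusp_relation_iv : 25 * (E4 ^+ 3 - E6 ^+ 2) = 420 * (288 * (D c * E4))
  + 432 * D (D (D (D E4))) + 360 * D (D (D E6)).
Proof. derivation_ring. Qed.

Lemma cusp_relation_v : 4 * (E4 ^+ 3 - E6 ^+ 2) = 40 * (81 * (b * E4 ^+ 2))
  + 15 * D (E2 * E4 ^+ 2) + 12 * D (E4 * E6).
Proof. derivation_ring. Qed.

Lemma cusp_relation_vi : 7 * (E4 ^+ 3 - E6 ^+ 2) = 9 * D (D (E4 ^+ 2))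
  + 36 * (288 * (c * E6)) - 9 * (288 * D (b * E6)).
Proof. derivation_ring. Qed.

Lemma cusp_relation_vii : 35 * (E4 ^+ 3 - E6 ^+ 2) = 72 * D (D (D E6))
  + 588 * (288 * (D c * E4)) - 252 * (288 * D (c * E4)).
Proof. derivation_ring. Qed.

Lemma cusp_relation_viii : 7 * (E4 ^+ 3 - E6 ^+ 2) = 36 * (288 * (c * E6)) - 16 * (288 * D (b * E6))
  - 12 * D (D (E2 * E6)).
Proof. derivation_ring. Qed.

Lemma cusp_relation_ix : 5 * (E4 ^+ 3 - E6 ^+ 2) = 864 * (28 * (D c * E4) + 3 * D (D (b * E4))
  - 21 * D (c * E4)).
Proof. derivation_ring. Qed.

End ChazyDerivation.

(** * Generating series of divisor sums and Ramanujan's equations *)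

Lemma fpsM_no_const (R : comNzRingType) (f g : fps R) (n : nat) :
  f 0%N = 0 -> g 0%N = 0 -> (f * g) n = \sum_(1 <= m < n) f m * g (n - m)%N.
Proof.
move=> f0 g0; rewrite fpsM -(big_mkord xpredT (fun m => f m * g (n - m)%N)).
case: n => [|n]; first by rewrite big_nat1 f0 mul0r big_geq.
by rewrite big_nat_recl // big_nat_recr //= subnn g0 mulr0 addr0 f0 mul0r add0r big_add1.
Qed.

Lemma fps_natMI (k : nat) (f g : fps rat) : (0 < k)%N -> k%:R * f = k%:R * g -> f = g.
Proof.
move=> k_gt0 E; apply: fpsP => n.
have := congr1 (fun F : fps rat => F n) E; rewrite !fps_natM; apply: mulfI.
by rewrite pnatr_eq0 -lt0n.
Qed.

(* The constant term is set to 0 by hand, as [divisors 0 = [:: 1]] gives [sigma k 0 = 1]. *)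
Definition sigma_series (k : nat) : fps rat :=
  Fps (fun n => if n is 0 then 0 else (sigma k n)%:R).

Local Notation L := sigma_series.

Lemma sigma_series0 (k : nat) : L k 0%N = 0. Proof. by []. Qed.

Lemma sigma_seriesS (k n : nat) : L k n.+1 = (sigma k n.+1)%:R. Proof. by []. Qed.

Lemma sigma_seriesE (k n : nat) : (0 < n)%N -> L k n = (sigma k n)%:R.
Proof. by case: n. Qed.

Lemma sigma_seriesM (i j n : nat) : (L i * L j) n = sigma_conv i j n.
Proof.
rewrite fpsM_no_const //; apply: eq_big_nat => m /andP[m_gt0 lt_mn].
by rewrite !sigma_seriesE ?subn_gt0.
Qed.

Lemma sigma_conv0 (i j : nat) : sigma_conv i j 0 = 0.
Proof. by rewrite /sigma_conv big_geq. Qed.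

Ltac fps_from_conv conv :=
  let n := fresh "n" in
  apply: fpsP => -[|n];
  rewrite ?(fpsD, fpsB, fpsN, fps_natM, thetaE, sigma_seriesM);
  [by rewrite !sigma_series0 !sigma_conv0 !(mulr0, oppr0, addr0)
  |have := conv n.+1 isT; rewrite !sigma_seriesS; lra].

Lemma L1L1 : 12 * (L 1 * L 1) = 5 * L 3 + L 1 - 6 * theta (L 1).
Proof. fps_from_conv sigma_conv11. Qed.

Lemma L1L3 : 240 * (L 1 * L 3) = 21 * L 5 + 10 * L 3 - 30 * theta (L 3) - L 1.
Proof. fps_from_conv sigma_conv13. Qed.

Lemma L3L3 : 120 * (L 3 * L 3) = L 7 - L 3.
Proof. fps_from_conv sigma_conv33. Qed.

(** The convolution of sigma_3 with itself is eliminated by means of [sigma_conv33]. *)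
Lemma L1L5 : 504 * (L 1 * L 5) = 20 * L 7 + 21 * L 5 - 42 * theta (L 5) + L 1.
Proof.
apply: fpsP => -[|n]; rewrite ?(fpsD, fpsB, fpsN, fps_natM, thetaE, sigma_seriesM).
  by rewrite !sigma_series0 !sigma_conv0 !(mulr0, oppr0, addr0).
have := @sigma_conv33 n.+1 isT; have := @sigma_conv15_33 n.+1 isT.
rewrite !sigma_seriesS; lra.
Qed.

Lemma L3L5 : 420 * (12 * (L 3 * L 5)) = 11 * L 9 - 21 * L 5 + 10 * L 3.
Proof. fps_from_conv sigma_conv35. Qed.

Lemma L3L7_L5L5 :
  630 * (16 * (L 3 * L 7) + 20 * (L 5 * L 5)) = 13 * L 11 - 42 * L 7 + 50 * L 5 - 21 * L 3.
Proof. fps_from_conv sigma_conv37_55. Qed.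

Definition E2 : fps rat := 1 - 24 * L 1.
Definition E4 : fps rat := 1 + 240 * L 3.
Definition E6 : fps rat := 1 - 504 * L 5.

Lemma theta_E2 : 12 * theta E2 = E2 ^+ 2 - E4.
Proof.
apply: (eq_lincomb (k := -48) L1L1).
by rewrite /E2 /E4 thetaD thetaN thetaM theta1 theta_nat; ring.
Qed.

Lemma theta_E4 : 3 * theta E4 = E2 * E4 - E6.
Proof.
apply: (eq_lincomb (k := 24) L1L3).
by rewrite /E2 /E4 /E6 thetaD thetaM theta1 theta_nat; ring.
Qed.

Lemma E4_sq : E4 ^+ 2 = 1 + 480 * L 7.
Proof. by apply: (eq_lincomb (k := 480) L3L3); rewrite /E4; ring. Qed.

Lemma theta_E6 : 2 * theta E6 = E2 * E6 - E4 ^+ 2.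
Proof.
rewrite E4_sq; apply: (eq_lincomb (k := -24) L1L5).
by rewrite /E2 /E6 thetaD thetaN thetaM theta1 theta_nat; ring.
Qed.

Lemma E4E6 : E4 * E6 = 1 - 264 * L 9.
Proof. by apply: (eq_lincomb (k := -24) L3L5); rewrite /E4 /E6; ring. Qed.

(** The right-hand side is 691 E12, with 65520 = 60 * 1092. *)
Lemma E12_E4_E6 : 441 * E4 ^+ 3 + 250 * E6 ^+ 2 = 691 * 1 + 60 * (1092 * L 11).
Proof.
apply: (eq_lincomb (k := 70 * 72) L3L7_L5L5).
by rewrite exprS E4_sq /E4 /E6; ring.
Qed.

Lemma theta_E2_L1 : theta E2 = - 24 * theta (L 1).
Proof. by rewrite /E2 thetaD thetaN thetaM theta1 theta_nat; ring. Qed.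

(** With [b = theta (L 1)] and [c = theta b], this and [E6_E2] are the hypotheses [E4E] and [E6E] on
    the derivation. *)
Lemma E4_E2 : E4 = E2 ^+ 2 + 288 * theta (L 1).
Proof. by apply: (eq_lincomb (k := 1) theta_E2); rewrite theta_E2_L1; ring. Qed.

Lemma E6_E2 : E6 = E2 ^+ 3 + 432 * E2 * theta (L 1) - 864 * theta (theta (L 1)).
Proof.
apply: (eq_lincomb (k := 1) theta_E4).
by rewrite (derivation_E4 (@thetaD _) (@thetaM _) E4_E2 theta_E2_L1 (erefl _)) E4_E2; ring.
Qed.

Lemma chazy : theta (theta (theta (L 1))) =
  E2 * theta (theta (L 1)) + 36 * theta (L 1) ^+ 2.
Proof.
apply: (@fps_natMI 1728) => //.
exact: (chazy_of_ramanujan (@thetaD _) (@thetaN _) (@thetaM _) E4_E2 E6_E2 theta_E2_L1 (erefl _)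
  theta_E6).
Qed.

(** * The product q prod (1 - q^k)^24 and its logarithmic derivative *)

Definition poly_fps (p : {poly int}) : fps rat := Fps (fun n => (p`_n)%:~R).

Lemma poly_fps1 : poly_fps 1 = 1.
Proof. by apply: fpsP => n; rewrite fps1 /= coef1; case: eqP. Qed.

Lemma poly_fpsB (p q : {poly int}) : poly_fps (p - q) = poly_fps p - poly_fps q.
Proof. by apply: fpsP => n; rewrite fpsB /= coefB rmorphB. Qed.

Lemma poly_fpsM (p q : {poly int}) : poly_fps (p * q) = poly_fps p * poly_fps q.
Proof.
apply: fpsP => n; rewrite fpsM /= coefM rmorph_sum.
by apply: eq_bigr => i _; rewrite rmorphM.
Qed.

Lemma theta_poly_fps (p : {poly int}) : theta (poly_fps p) = poly_fps ('X * p^`()).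
Proof.
apply: fpsP => -[|n]; rewrite thetaE /= coefXM //= ?mul0r //.
by rewrite coef_deriv rmorphMn mulr_natl.
Qed.

(** The logarithmic derivative theta f / f = g, stated without division. *)
Definition log_theta (g f : fps rat) := theta f = g * f.

Lemma log_thetaM (g1 g2 f1 f2 : fps rat) :
  log_theta g1 f1 -> log_theta g2 f2 -> log_theta (g1 + g2) (f1 * f2).
Proof. by rewrite /log_theta thetaM => -> ->; ring. Qed.

Lemma log_thetaX (g f : fps rat) (k : nat) :
  log_theta g f -> log_theta (k%:R * g) (f ^+ k).
Proof.
move=> gf; elim: k => [|k IHk].
  by rewrite /log_theta expr0 theta1 !mul0r.
by rewrite exprS -[k.+1%:R]natr1 mulrDl mul1r addrC; apply: log_thetaM.
Qed.

(** The series q^k / (1 - q^k) = q^k + q^(2k) + ...; the guard [0 < n] is there because k divides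
    0. *)
Definition geometric (k : nat) : fps rat := Fps (fun n => ((0 < n) && (k %| n))%N%:R).

Lemma geometricE (k : nat) : (0 < k)%N ->
  (1 - poly_fps 'X^k) * geometric k = poly_fps 'X^k.
Proof.
move=> k_gt0; apply: fpsP => n; rewrite mulrBl mul1r fpsB fpsM /=.
have [lt_nk | le_kn] := ltnP n k.
  rewrite big1 => [|i _].
    rewrite coefXn (ltn_eqF lt_nk); case: n lt_nk => [|n] lt_nk; first by rewrite subr0.
    by rewrite gtnNdvd // subr0.
  by rewrite coefXn (ltn_eqF (leq_ltn_trans _ lt_nk)) ?mul0r // -ltnS.
have le_k : (k < n.+1)%N by [].
rewrite (bigD1 (Ordinal le_k)) //= coefXn eqxx mul1r big1 ?addr0; last first.
  move=> i /eqP ne_ik; rewrite coefXn; case: eqP => [/= e|]; rewrite ?mul0r //.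
  by case: ne_ik; apply: val_inj.
have -> : (k %| n - k)%N = (k %| n)%N.
  by rewrite -[X in _ = (_ %| X)%N](subnK le_kn) dvdn_addl.
rewrite (leq_trans k_gt0 le_kn) /= subn_gt0 coefXn.
have [-> | ne_nk] := eqVneq n k; first by rewrite ltnn dvdnn subr0.
by rewrite ltn_neqAle eq_sym ne_nk le_kn subrr.
Qed.

Lemma log_theta_1subXn (k : nat) : (0 < k)%N ->
  log_theta (- k%:R * geometric k) (poly_fps (1 - 'X^k)).
Proof.
move=> k_gt0; rewrite /log_theta poly_fpsB poly_fps1 thetaD thetaN theta1.
have -> : theta (poly_fps 'X^k) = k%:R * poly_fps 'X^k.
  apply: fpsP => n; rewrite fps_natM thetaE /= coefXn.
  by have [-> | ne_nk] := eqVneq n k; rewrite ?mulr0.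
rewrite -{1}(geometricE k_gt0); ring.
Qed.

(** The factor q contributes 1, and each (1 - q^k)^24 contributes -24 k q^k / (1 - q^k). *)
Lemma log_theta_delta_trunc (N : nat) :
  log_theta (1 - 24 * \sum_(1 <= k < N.+1) k%:R * geometric k) (poly_fps (delta_trunc N)).
Proof.
elim: N => [|N IHN].
  rewrite /log_theta /delta_trunc !big_geq // mulr1 mulr0 subr0 mul1r.
  by rewrite theta_poly_fps derivX mulr1.
have -> : delta_trunc N.+1 = delta_trunc N * (1 - 'X^(N.+1)) ^+ 24.
  by rewrite /delta_trunc big_nat_recr //= mulrA.
have polyX p k : poly_fps (p ^+ k) = poly_fps p ^+ k.
  by elim: k => [|k IHk]; rewrite ?poly_fps1 // !exprS poly_fpsM IHk.
rewrite poly_fpsM polyX big_nat_recr //=.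
have := log_thetaM IHN (log_thetaX 24 (log_theta_1subXn (ltn0Sn N))).
congr (log_theta _ _); ring.
Qed.

Definition tau_series : fps rat := Fps (fun n => (tau n)%:~R).

(** The n-th coefficient only involves the product truncated at n, and for 0 < i <= n the k <= n
    dividing i are all the divisors of i, so the logarithmic derivative agrees with [E2] up to
    degree n. *)
Lemma theta_tau : theta tau_series = E2 * tau_series.
Proof.
apply: fpsP => n; have := congr1 (fun f : fps rat => f n) (log_theta_delta_trunc n).
rewrite !thetaE fpsM fpsM /= => ->; apply: eq_bigr => i _.
rewrite tau_stable ?leq_subr //; congr (_ * _).
rewrite /E2 !fpsB !fps_natM fps_sum; congr (_ - _ * _).
have [i0 | i_gt0] := posnP i.
  by rewrite i0 /= big1 // => k _; rewrite fps_natM /= mulr0.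
rewrite sigma_seriesE // natr_sigma.
transitivity (\sum_(1 <= k < n.+1 | (k %| i)%N) k%:R : rat).
  rewrite [RHS]big_mkcond /=; apply: eq_bigr => k _; rewrite fps_natM /= i_gt0.
  by case: (k %| i)%N; rewrite ?mulr1 ?mulr0.
rewrite -big_filter; under [RHS]eq_bigr do rewrite expr1.
apply: perm_big; apply: uniq_perm; rewrite ?divisors_uniq ?filter_uniq ?iota_uniq //.
move=> k; rewrite -dvdn_divisors // mem_filter mem_index_iota.
case: (boolP (k %| i)%N) => //= ki; rewrite (dvdn_gt0 i_gt0 ki) /= ltnS.
by rewrite (leq_trans (dvdn_leq i_gt0 ki)) // -ltnS.
Qed.

Lemma tau1 : tau 1 = 1.
Proof.
rewrite /tau /delta_trunc big_nat1 expr1 coefXM /=.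
by rewrite -[X in X = _]/(_`_0) -horner_coef0 !hornerE.
Qed.

(* As [E2 0 = 1], comparing the coefficients of q^n expresses (n - 1) f_n in the previous ones. *)
Lemma theta_E2_unique (f : fps rat) : theta f = E2 * f -> f 1%N = 0 -> f = 0.
Proof.
move=> fE f1; apply: fpsP => n; elim/ltn_ind: n => n IHn.
have [-> // | n_neq1] := eqVneq n 1%N.
have := congr1 (fun g : fps rat => g n) fE.
rewrite thetaE fpsM big_ord_recl /= subn0 big1 ?addr0 => [|i _]; last first.
  by rewrite IHn ?mulr0 // /bump /=; case: i => i /= lt_in; rewrite subnSK ?leq_subr // ltnS.
have -> : E2 0%N = 1 by rewrite /E2 fpsB fps_natM mulr0 subr0.
move=> /eqP; rewrite mul1r -subr_eq0 -{2}[f n]mul1r -mulrBl mulf_eq0 subr_eq0.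
by rewrite (eqr_nat _ n 1) (negbTE n_neq1) => /eqP.
Qed.

Lemma cusp_tau : E4 ^+ 3 - E6 ^+ 2 = 1728 * tau_series.
Proof.
apply: subr0_eq; apply: theta_E2_unique.
  rewrite thetaD thetaN [theta (1728 * _)]thetaM theta_nat theta_tau.
  rewrite (derivation_cusp (@thetaD _) (@thetaN _) (@thetaM _)
    E4_E2 E6_E2 theta_E2_L1 (erefl _) chazy).
  by ring.
(* What remains is the coefficient of q: 3 * 240 + 2 * 504 = 1728. *)
have coefM0 (f g : fps rat) : (f * g) 0%N = f 0%N * g 0%N.
  by rewrite fpsM big_ord1.
have coefM1 (f g : fps rat) : (f * g) 1%N = f 0%N * g 1%N + f 1%N * g 0%N.
  by rewrite fpsM big_ord_recl big_ord1.
have E40 : E4 0%N = 1 by rewrite /E4 fpsD fps_natM mulr0 addr0.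
have E60 : E6 0%N = 1 by rewrite /E6 fpsB fps_natM mulr0 subr0.
have L1 k : L k 1%N = 1 by rewrite /= /sigma big_seq1 exp1n.
have E41 : E4 1%N = 240 by rewrite /E4 fpsD fps_natM L1 fps1 mulr1; apply: add0r.
have E61 : E6 1%N = - 504 by rewrite /E6 fpsB fps_natM L1 fps1 mulr1; apply: sub0r.
rewrite !fpsB fps_natM !exprS !expr0 !mulr1 !(coefM1, coefM0) E40 E60 E41 E61 [tau_series _]/= tau1.
ring.
Qed.

(** * Coefficients *)

Lemma sigma_moment (e j n : nat) :
  (iter e (@theta _) (L 1) * L j) n =
  \sum_(1 <= m < n) m%:R ^+ e * (sigma 1 m)%:R * (sigma j (n - m))%:R.
Proof.
have iterE k : iter e (@theta _) (L 1) k = k%:R ^+ e * L 1 k.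
  elim: e => [|e IHe]; first by rewrite mul1r.
  by rewrite iterS thetaE IHe exprS mulrA.
rewrite fpsM_no_const ?iterE ?mulr0 //; apply: eq_big_nat => m /andP[m_gt0 lt_mn].
by rewrite iterE !sigma_seriesE ?subn_gt0.
Qed.

Section Identities.

Variables (n : nat) (n_gt0 : (0 < n)%N).

Local Notation s k := ((sigma k n)%:R : rat).
Local Notation N := (n%:R : rat).
Local Notation M e j := (\sum_(1 <= m < n) m%:R ^+ e * (sigma 1 m)%:R * (sigma j (n - m)%N)%:R).

Lemma fps_1D (f : fps rat) : (1 + f) n = f n.
Proof. by rewrite fpsD fps1 (gtn_eqF n_gt0) add0r. Qed.

Lemma E4_coef : E4 n = 240 * s 3.
Proof. by rewrite /E4 fps_1D fps_natM sigma_seriesE. Qed.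

Lemma E6_coef : E6 n = - (504 * s 5).
Proof. by rewrite /E6 fps_1D fpsN fps_natM sigma_seriesE. Qed.

Lemma E8_coef : (E4 ^+ 2) n = 480 * s 7.
Proof. by rewrite E4_sq fps_1D fps_natM sigma_seriesE. Qed.

Lemma E10_coef : (E4 * E6) n = - (264 * s 9).
Proof. by rewrite E4E6 fps_1D fpsN fps_natM sigma_seriesE. Qed.

Lemma E12_coef : 441 * (E4 ^+ 3) n + 250 * (E6 ^+ 2) n = 60 * (1092 * s 11).
Proof.
(* The multipliers are variables here, so that taking coefficients does not touch the numerals. *)
have lincomb (k0 k1 k2 k3 : nat) (f0 f1 f2 f3 : fps rat) :
    k0%:R * f0 + k1%:R * f1 = k2%:R * f2 + k3%:R * f3 ->
    k0%:R * f0 n + k1%:R * f1 n = k2%:R * f2 n + k3%:R * f3 n.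
  by move/(congr1 (fun f : fps rat => f n)); rewrite !fpsD !fps_natM.
have := lincomb _ _ _ _ _ _ _ _ E12_E4_E6.
have -> : (1 : fps rat) n = 0 by rewrite fps1 (gtn_eqF n_gt0).
have -> : (1092 * L 11) n = 1092 * s 11 by rewrite (fps_natM 1092 (L 11) n) sigma_seriesE.
lra.
Qed.

Lemma cusp_coef : (E4 ^+ 3) n - (E6 ^+ 2) n = 1728 * (tau n)%:~R.
Proof. by rewrite -fpsB cusp_tau; apply: fps_natM. Qed.

Lemma E2M_coef (f : fps rat) : (E2 * f) n = f n - 24 * (L 1 * f) n.
Proof.
have -> : E2 * f = f - 24 * (L 1 * f) by rewrite /E2; ring.
by rewrite fpsB fps_natM.
Qed.

Lemma iter_theta_coef (e : nat) (f : fps rat) : iter e (@theta _) f n = N ^+ e * f n.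
Proof.
elim: e => [|e IHe]; first by rewrite mul1r.
by rewrite iterS thetaE IHe exprS mulrA.
Qed.

Lemma moment_E4 (e : nat) : (iter e (@theta _) (L 1) * E4) n = N ^+ e * s 1 + 240 * M e 3.
Proof.
have -> (f : fps rat) : f * E4 = f + 240 * (f * L 3) by rewrite /E4; ring.
by rewrite fpsD fps_natM sigma_moment iter_theta_coef sigma_seriesE.
Qed.

Lemma moment_E6 (e : nat) : (iter e (@theta _) (L 1) * E6) n = N ^+ e * s 1 - 504 * M e 5.
Proof.
have -> (f : fps rat) : f * E6 = f - 504 * (f * L 5) by rewrite /E6; ring.
by rewrite fpsB fps_natM sigma_moment iter_theta_coef sigma_seriesE.
Qed.

Lemma moment_E8 (e : nat) : (iter e (@theta _) (L 1) * E4 ^+ 2) n = N ^+ e * s 1 + 480 * M e 7.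
Proof.
have -> (f : fps rat) : f * E4 ^+ 2 = f + 480 * (f * L 7) by rewrite E4_sq; ring.
by rewrite fpsD fps_natM sigma_moment iter_theta_coef sigma_seriesE.
Qed.

Lemma moment_E10 (e : nat) : (iter e (@theta _) (L 1) * (E4 * E6)) n = N ^+ e * s 1 - 264 * M e 9.
Proof.
have -> (f : fps rat) : f * (E4 * E6) = f - 264 * (f * L 9) by rewrite E4E6; ring.
by rewrite fpsB fps_natM sigma_moment iter_theta_coef sigma_seriesE.
Qed.

(** Splits the weights of identities (v) to (ix) into powers of m; the coefficients may involve
    [n]. *)
Lemma moment_cubic (j : nat) (x0 x1 x2 x3 : rat) :
  \sum_(1 <= m < n) (x0 + x1 * m%:R + x2 * m%:R ^+ 2 + x3 * m%:R ^+ 3)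
    * (sigma 1 m)%:R * (sigma j (n - m)%N)%:R =
  x0 * M 0 j + x1 * M 1 j + x2 * M 2 j + x3 * M 3 j.
Proof.
rewrite !mulr_sumr -!big_split /=; apply: eq_bigr => m _; ring.
Qed.

End Identities.

(** * The nine identities *)

Local Notation moment n e j :=
  (\sum_(1 <= m < n) m%:R ^+ e * (sigma 1 m)%:R * (sigma j (n - m)%N)%:R : rat).

#[local] Opaque E2 E4 E6.

Ltac at_coef H :=
  match goal with hn : is_true (0 < ?n)%N |- _ =>
    have := congr1 (fun f : fps rat => f n) H;
    rewrite /= !(fps_natM, thetaE, E2M_coef, E4_coef hn, E6_coef hn, E8_coef hn, E10_coef hn,
      fpsD, fpsB, fpsN)
  end.

Theorem theorem2p7 (n : nat) (hn : (1 <= n)%N) :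
  (* (i) *)
  ((tau n)%:~R : rat) =
    5 * 691 / 9504 * (sigma 1 n)%:R
    - (6 * n%:R - 5) * 691 / 864 * (sigma 9 n)%:R
    + 2275 / 1584 * (sigma 11 n)%:R
    - 5 * 691 / 36
      * \sum_(1 <= m < n) (sigma 1 m)%:R * (sigma 9 (n - m)%N)%:R
  /\
  (* (ii) *)
  ((tau n)%:~R : rat) =
    15 / 32 * n%:R * (sigma 1 n)%:R
    - 33 / 32 * n%:R * (sigma 9 n)%:R
    + 50 / 32 * n%:R ^+ 2 * (sigma 7 n)%:R
    + 225 * \sum_(1 <= m < n) m%:R * (sigma 1 m)%:R * (sigma 7 (n - m)%N)%:R
  /\
  (* (iii) *)
  ((tau n)%:~R : rat) =
    6 / 7 * n%:R ^+ 2 * (sigma 1 n)%:R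
    - 9 / 7 * n%:R ^+ 3 * (sigma 5 n)%:R
    + 10 / 7 * n%:R ^+ 2 * (sigma 7 n)%:R
    - 24 * 18
      * \sum_(1 <= m < n) m%:R ^+ 2 * (sigma 1 m)%:R * (sigma 5 (n - m)%N)%:R
  /\
  (* (iv) *)
  ((tau n)%:~R : rat) =
    14 / 5 * n%:R ^+ 3 * (sigma 1 n)%:R
    + 12 / 5 * n%:R ^+ 4 * (sigma 3 n)%:R
    - 21 / 5 * n%:R ^+ 3 * (sigma 5 n)%:R
    + 24 * 28
      * \sum_(1 <= m < n) m%:R ^+ 3 * (sigma 1 m)%:R * (sigma 3 (n - m)%N)%:R
  /\
  (* (v) *)
  ((tau n)%:~R : rat) =
    5 / 12 * n%:R * (sigma 1 n)%:R
    + 25 / 24 * n%:R * (sigma 7 n)%:R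
    - 11 / 24 * n%:R * (sigma 9 n)%:R
    + 25 * \sum_(1 <= m < n)
        (9 * m%:R - n%:R) * (sigma 1 m)%:R * (sigma 7 (n - m)%N)%:R
  /\
  (* (vi) *)
  ((tau n)%:~R : rat) =
    9 / 14 * n%:R ^+ 2 * (sigma 1 n)%:R
    + 5 / 14 * n%:R ^+ 2 * (sigma 7 n)%:R
    - 108 * \sum_(1 <= m < n)
        (4 * m%:R ^+ 2 - m%:R * n%:R)
        * (sigma 1 m)%:R * (sigma 5 (n - m)%N)%:R
  /\
  (* (vii) *)
  ((tau n)%:~R : rat) =
    8 / 5 * n%:R ^+ 3 * (sigma 1 n)%:R
    - 3 / 5 * n%:R ^+ 3 * (sigma 5 n)%:R
    + 96 * \sum_(1 <= m < n)
        (7 * m%:R ^+ 3 - 3 * m%:R ^+ 2 * n%:R)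
        * (sigma 1 m)%:R * (sigma 3 (n - m)%N)%:R
  /\
  (* (viii) *)
  ((tau n)%:~R : rat) =
    1 / 2 * n%:R ^+ 2 * (sigma 1 n)%:R
    + 1 / 2 * n%:R ^+ 2 * (sigma 5 n)%:R
    - 12 * \sum_(1 <= m < n)
        (36 * m%:R ^+ 2 - 16 * m%:R * n%:R + n%:R ^+ 2)
        * (sigma 1 m)%:R * (sigma 5 (n - m)%N)%:R
  /\
  (* (ix) *)
  ((tau n)%:~R : rat) =
    n%:R ^+ 3 * (sigma 1 n)%:R
    - 24 * \sum_(1 <= m < n)
        (21 * m%:R ^+ 2 * n%:R - 28 * m%:R ^+ 3 - 3 * m%:R * n%:R ^+ 2)
        * (sigma 1 m)%:R * (sigma 3 (n - m)%N)%:R.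
Proof.
repeat apply: conj.
(* Three linear equations, from the cusp form, E12 and the relation, determine the coefficients of
   E4^3 and E6^2 together with [tau n]. *)
- have -> : \sum_(1 <= m < n) (sigma 1 m)%:R * (sigma 9 (n - m)%N)%:R = moment n 0 9.
    by apply: eq_bigr => m _; rewrite expr0 mul1r.
  have m0_10 : (L 1 * (E4 * E6)) n = _ := moment_E10 hn 0.
  have := cusp_coef n.
  have := E12_coef hn.
  at_coef (cusp_relation_i (@thetaD _) (@thetaN _) (@thetaM _)
    E4_E2 E6_E2 theta_E2_L1 (erefl _) chazy).
  rewrite m0_10; lra.
(* From here on the relation contains E4^3 - E6^2 itself, so [cusp_coef] suffices. The ascribed type
   unfolds [iter] to the [theta] form that the relation produces. *)
- have m1_8 : (theta (L 1) * E4 ^+ 2) n = _ := moment_E8 hn 1.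
  have := cusp_coef n.
  at_coef (cusp_relation_ii (@thetaD _) (@thetaN _) (@thetaM _)
    E4_E2 E6_E2 theta_E2_L1 (erefl _) chazy).
  rewrite m1_8; lra.
- have m2_6 : (theta (theta (L 1)) * E6) n = _ := moment_E6 hn 2.
  have := cusp_coef n.
  at_coef (cusp_relation_iii (@thetaD _) (@thetaN _) (@thetaM _)
    E4_E2 E6_E2 theta_E2_L1 (erefl _) chazy).
  rewrite m2_6; lra.
- have m3_4 : (theta (theta (theta (L 1))) * E4) n = _ := moment_E4 hn 3.
  have := cusp_coef n.
  at_coef (cusp_relation_iv (@thetaD _) (@thetaN _) (@thetaM _)
    E4_E2 E6_E2 theta_E2_L1 (erefl _) chazy).
  rewrite m3_4; lra.
(* The weight mixes m and n, so the sum is first separated into pure moments, with the powers of n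
   as coefficients. *)
- have -> : \sum_(1 <= m < n) (9 * m%:R - n%:R)
      * (sigma 1 m)%:R * (sigma 7 (n - m)%N)%:R =
      9 * moment n 1 7 - n%:R * moment n 0 7 :> rat.
    transitivity (\sum_(1 <= m < n) (- n%:R + 9 * m%:R + 0 * m%:R ^+ 2 + 0 * m%:R ^+ 3)
        * (sigma 1 m)%:R * (sigma 7 (n - m)%N)%:R : rat).
      by apply: eq_bigr => m _; ring.
    by rewrite moment_cubic; ring.
  have m0_8 : (L 1 * E4 ^+ 2) n = _ := moment_E8 hn 0.
  have m1_8 : (theta (L 1) * E4 ^+ 2) n = _ := moment_E8 hn 1.
  have := cusp_coef n.
  at_coef (cusp_relation_v (@thetaD _) (@thetaN _) (@thetaM _)
    E4_E2 E6_E2 theta_E2_L1 (erefl _) chazy).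
  rewrite m0_8 m1_8; lra.
- have -> : \sum_(1 <= m < n) (4 * m%:R ^+ 2 - m%:R * n%:R)
      * (sigma 1 m)%:R * (sigma 5 (n - m)%N)%:R =
      4 * moment n 2 5 - n%:R * moment n 1 5 :> rat.
    transitivity (\sum_(1 <= m < n) (0 + - n%:R * m%:R + 4 * m%:R ^+ 2 + 0 * m%:R ^+ 3)
        * (sigma 1 m)%:R * (sigma 5 (n - m)%N)%:R : rat).
      by apply: eq_bigr => m _; ring.
    by rewrite moment_cubic; ring.
  have m1_6 : (theta (L 1) * E6) n = _ := moment_E6 hn 1.
  have m2_6 : (theta (theta (L 1)) * E6) n = _ := moment_E6 hn 2.
  have := cusp_coef n.
  at_coef (cusp_relation_vi (@thetaD _) (@thetaN _) (@thetaM _)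
    E4_E2 E6_E2 theta_E2_L1 (erefl _) chazy).
  rewrite m1_6 m2_6; lra.
- have -> : \sum_(1 <= m < n) (7 * m%:R ^+ 3 - 3 * m%:R ^+ 2 * n%:R)
      * (sigma 1 m)%:R * (sigma 3 (n - m)%N)%:R =
      7 * moment n 3 3 - 3 * n%:R * moment n 2 3 :> rat.
    transitivity (\sum_(1 <= m < n) (0 + 0 * m%:R + (- 3 * n%:R) * m%:R ^+ 2 + 7 * m%:R ^+ 3)
        * (sigma 1 m)%:R * (sigma 3 (n - m)%N)%:R : rat).
      by apply: eq_bigr => m _; ring.
    by rewrite moment_cubic; ring.
  have m2_4 : (theta (theta (L 1)) * E4) n = _ := moment_E4 hn 2.
  have m3_4 : (theta (theta (theta (L 1))) * E4) n = _ := moment_E4 hn 3.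
  have := cusp_coef n.
  at_coef (cusp_relation_vii (@thetaD _) (@thetaN _) (@thetaM _)
    E4_E2 E6_E2 theta_E2_L1 (erefl _) chazy).
  rewrite m2_4 m3_4; lra.
- have -> : \sum_(1 <= m < n) (36 * m%:R ^+ 2 - 16 * m%:R * n%:R + n%:R ^+ 2)
      * (sigma 1 m)%:R * (sigma 5 (n - m)%N)%:R =
      36 * moment n 2 5 - 16 * n%:R * moment n 1 5 + n%:R ^+ 2 * moment n 0 5 :> rat.
    transitivity (\sum_(1 <= m < n) (n%:R ^+ 2 + (- 16 * n%:R) * m%:R + 36 * m%:R ^+ 2 + 0 * m%:R ^+ 3)
        * (sigma 1 m)%:R * (sigma 5 (n - m)%N)%:R : rat).
      by apply: eq_bigr => m _; ring.
    by rewrite moment_cubic; ring.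
  have m0_6 : (L 1 * E6) n = _ := moment_E6 hn 0.
  have m1_6 : (theta (L 1) * E6) n = _ := moment_E6 hn 1.
  have m2_6 : (theta (theta (L 1)) * E6) n = _ := moment_E6 hn 2.
  have := cusp_coef n.
  at_coef (cusp_relation_viii (@thetaD _) (@thetaN _) (@thetaM _)
    E4_E2 E6_E2 theta_E2_L1 (erefl _) chazy).
  rewrite m0_6 m1_6 m2_6; lra.
- have -> : \sum_(1 <= m < n) (21 * m%:R ^+ 2 * n%:R - 28 * m%:R ^+ 3 - 3 * m%:R * n%:R ^+ 2)
      * (sigma 1 m)%:R * (sigma 3 (n - m)%N)%:R =
      21 * n%:R * moment n 2 3 - 28 * moment n 3 3 - 3 * n%:R ^+ 2 * moment n 1 3 :> rat.
    transitivity (\sum_(1 <= m < n) (0 + (- 3 * n%:R ^+ 2) * m%:R + (21 * n%:R) * m%:R ^+ 2 + - 28 * m%:R ^+ 3)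
        * (sigma 1 m)%:R * (sigma 3 (n - m)%N)%:R : rat).
      by apply: eq_bigr => m _; ring.
    by rewrite moment_cubic; ring.
  have m1_4 : (theta (L 1) * E4) n = _ := moment_E4 hn 1.
  have m2_4 : (theta (theta (L 1)) * E4) n = _ := moment_E4 hn 2.
  have m3_4 : (theta (theta (theta (L 1))) * E4) n = _ := moment_E4 hn 3.
  have := cusp_coef n.
  at_coef (cusp_relation_ix (@thetaD _) (@thetaN _) (@thetaM _)
    E4_E2 E6_E2 theta_E2_L1 (erefl _) chazy).
  rewrite m1_4 m2_4 m3_4; lra.
Qed.
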